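(* Let $X$ be a real or complex Banach space, let $U:\Delta_{+}\to\mathcal{B}(X)$ be an evolution operator and let $P:\mathbb{R}_{+}\to\mathcal{B}(X)$ be a projection valued function compatible with $U$ (with $Q(t)=Id-P(t)$). Then $U$ has a uniform exponential dichotomy with the dichotomy projection $P(\cdot)$ if and only if $U$ has $P$-uniform exponential growth and there exist a function $L:\mathbb{R}_{+}\times X\to\mathbb{R}$ and a constant $K\geq 1$ such that, for all $(t,s)\in\Delta_{+}$ and $x\in X$: (1) $L(t,U(t,s)x)+\int_{s}^{t}\|U(\tau,s)x\|^{2}\,d\tau\leq L(s,x)$; (2) $L(t,P(t)x)\geq 0$; (3) $L(t,Q(t)x)\leq 0$; (4) $L(t,P(t)x)-L(t,Q(t)x)\leq K\|x\|^{2}$.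
   Context: Let $X$ be a real or complex Banach space, $\mathcal{B}(X)$ the Banach algebra of bounded linear operators on $X$, and $\Delta_{+}=\{(t,s)\in\mathbb{R}_{+}\times\mathbb{R}_{+}: t\geq s\}$, where $\mathbb{R}_+=[0,\infty)$. Evolution operator: a map $U:\Delta_{+}\to\mathcal{B}(X)$ with $U(t,t)=Id$ for all $t\ge 0$; $U(t,s)U(s,t_0)=U(t,t_0)$ for all $t\geq s\geq t_0\ge 0$; and $(t,s)\mapsto U(t,s)x$ continuous on $\Delta_{+}$ for every $x\in X$. Projection valued function: a strongly continuous map $P:\mathbb{R}_{+}\to\mathcal{B}(X)$ with $P(t)^2=P(t)$ for all $t$; write $Q(t)=Id-P(t)$, so $\operatorname{Ker}P(t)=\operatorname{Range}Q(t)$. Compatibility: $P(\cdot)$ is compatible with $U$ if $P(t)U(t,s)=U(t,s)P(s)$ for all $(t,s)\in\Delta_{+}$ and the restriction $U(t,s)|_{\operatorname{Ker}P(s)}:\operatorname{Ker}P(s)\to\operatorname{Ker}P(t)$ is an isomorphism for each $(t,s)\in\Delta_{+}$; its inverse is denoted $V(s,t):\operatorname{Ker}P(t)\to\operatorname{Ker}P(s)$. Uniform exponential dichotomy with dichotomy projection $P(\cdot)$ (where $P$ is compatible with $U$): there exist $N\geq1$ and $\beta>0$ with $\|U(t,s)P(s)\|\leq Ne^{-\beta(t-s)}$ and $\|V(s,t)Q(t)\|\leq Ne^{-\beta(t-s)}$ for all $(t,s)\in\Delta_{+}$. $P$-uniform exponential growth: there exist $M\geq1$ and $\omega>0$ with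 $\|U(t,s)P(s)\|\leq Me^{\omega(t-s)}$ and $\|V(s,t)Q(t)\|\leq Me^{\omega(t-s)}$ for all $(t,s)\in\Delta_{+}$. *)

(* Defs.v *)
From Stdlib Require Import Reals.
From Coquelicot Require Import Coquelicot.

Set Implicit Arguments.
Open Scope R_scope.

(* A family indexed by Delta_+ = {(t,s) : t >= s >= 0} (resp. by R_+) is a total
   function of the real parameters, about which all hypotheses and conclusions
   are restricted to Delta_+ (resp. R_+); other values are irrelevant. *)

(* Supremum of |T x| over the closed unit ball, in the extended reals: an
   inequality [op_norm T <= c] with c real includes the boundedness of T. *)
Definition op_norm {K : AbsRing} {X Y : NormedModule K} (T : X -> Y) : Rbar :=
  Lub_Rbar (fun r => exists x : X, norm x <= 1 /\ r = norm (T x)).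

Record evolution_operator {K : AbsRing} {X : NormedModule K}
    (U : R -> R -> X -> X) : Prop := {
  evo_bounded_linear : forall t s, 0 <= s <= t -> is_linear (U t s);
  evo_id : forall t x, 0 <= t -> U t t x = x;
  evo_comp : forall t s t0 x, 0 <= t0 -> t0 <= s -> s <= t ->
    U t s (U s t0 x) = U t t0 x;
  evo_continuous : forall x : X,
    continuous_on (fun p : R * R => 0 <= snd p <= fst p)
                  (fun p => U (fst p) (snd p) x)
}.

Record projection_valued {K : AbsRing} {X : NormedModule K}
    (P : R -> X -> X) : Prop := {
  proj_bounded_linear : forall t, 0 <= t -> is_linear (P t);
  proj_idem : forall t x, 0 <= t -> P t (P t x) = P t x;
  proj_continuous : forall x : X, continuous_on (fun t => 0 <= t) (fun t => P t x)
}.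

Definition compl_proj {K : AbsRing} {X : NormedModule K}
    (P : R -> X -> X) (t : R) (x : X) : X := minus x (P t x).

Definition kernel {K : AbsRing} {X Y : NormedModule K} (T : X -> Y) (x : X) : Prop :=
  T x = zero.

(* The inverse of the restriction of T to A ([iota] is definite description);
   meaningful at y only if y has exactly one preimage in A. *)
Definition inverse_on {K : AbsRing} {X : CompleteNormedModule K}
    (A : X -> Prop) (T : X -> X) (y : X) : X :=
  iota (fun x => A x /\ T x = y).

(* For a bounded linear T and subspaces A, B: the restriction of T is an
   isomorphism of normed spaces from A onto B. *)
Definition isomorphism_on {K : AbsRing} {X : CompleteNormedModule K}
    (A B : X -> Prop) (T : X -> X) : Prop :=
  (forall x, A x -> B (T x)) /\
  (forall y, B y -> exists! x, A x /\ T x = y) /\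
  (exists c : R, forall y, B y -> norm (inverse_on A T y) <= c * norm y).

Definition compatible {K : AbsRing} {X : CompleteNormedModule K}
    (U : R -> R -> X -> X) (P : R -> X -> X) : Prop :=
  forall t s, 0 <= s <= t ->
    (forall x, P t (U t s x) = U t s (P s x)) /\
    isomorphism_on (kernel (P s)) (kernel (P t)) (U t s).

(* V(s,t) : Ker P(t) -> Ker P(s). *)
Definition kernel_inverse {K : AbsRing} {X : CompleteNormedModule K}
    (U : R -> R -> X -> X) (P : R -> X -> X) (s t : R) : X -> X :=
  inverse_on (kernel (P s)) (U t s).

Definition uniform_exp_dichotomy {K : AbsRing} {X : CompleteNormedModule K}
    (U : R -> R -> X -> X) (P : R -> X -> X) : Prop :=
  exists N beta : R, 1 <= N /\ 0 < beta /\
    forall t s, 0 <= s <= t ->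
      Rbar_le (op_norm (fun x => U t s (P s x)))
              (N * exp (- beta * (t - s))) /\
      Rbar_le (op_norm (fun x => kernel_inverse U P s t (compl_proj P t x)))
              (N * exp (- beta * (t - s))).

Definition uniform_exp_growth {K : AbsRing} {X : CompleteNormedModule K}
    (U : R -> R -> X -> X) (P : R -> X -> X) : Prop :=
  exists M omega : R, 1 <= M /\ 0 < omega /\
    forall t s, 0 <= s <= t ->
      Rbar_le (op_norm (fun x => U t s (P s x)))
              (M * exp (omega * (t - s))) /\
      Rbar_le (op_norm (fun x => kernel_inverse U P s t (compl_proj P t x)))
              (M * exp (omega * (t - s))).

(* Main.v *)
Require Import Defs.
From Stdlib Require Import Reals Lra.
From Coquelicot Require Import Coquelicot.

(** Necessity is an explicit construction.  Given a dichotomy, put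
    L(t,x) = 2 int_t^oo |U(tau,t)P(t)x|^2 dtau - 2 int_0^t |V(tau,t)Q(t)x|^2 dtau.
    Both integrals are at most N^2 |x|^2 / (2 beta), because the integrands decay
    exponentially away from t; this gives (4), while (2) and (3) hold because
    only one of the two integrals is non-zero on the range of P(t), resp. of
    Q(t).  Along an orbit x -> U(t,s)x the first integral loses the piece over
    [s,t] and the second one gains it, so L drops by
    2 int_s^t (|U(tau,s)P(s)x|^2 + |U(tau,s)Q(s)x|^2) dtau, and by
    |p+q|^2 <= 2|p|^2 + 2|q|^2 this is at least the energy
    int_s^t |U(tau,s)x|^2 dtau ([lyapunov_decrease], [lyapunov_bounds]).

    Sufficiency is an argument of Datko type.  Conditions (1)-(4) say that the
    energy of a stable orbit from s on is at most k |P(s)x|^2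
    ([stable_energy_bound]), and that the energy of an orbit in the kernels up
    to time t is at most k times the square of its norm at t
    ([unstable_energy_bound]).  For a scalar function u with
    int_s^b u^2 <= k u(s)^2, the tail integral Phi(s) satisfies
    Phi' = - u^2 <= - Phi / k, hence decays exponentially
    ([tail_integral_decay]); exponential growth turns this integral decay into a
    pointwise one ([datko_forward]).  The unstable part is the same statement
    with time reversed ([datko_backward]): the backward orbit V(tau,t)Q(t)x is the forward
    orbit U(tau,s)z of z = V(s,t)Q(t)x read from right to left, so the strong
    continuity of U is all the regularity that it needs. *)

(** * Integrals of squares of scalar functions *)

Lemma exp_monotone (x y : R) : x <= y -> exp x <= exp y.
Proof.
intros [Hxy | ->]; [apply Rlt_le, exp_increasing, Hxy | apply Rle_refl].
Qed.

Lemma continuous_sq (f : R -> R) (t : R) :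
  continuous f t -> continuous (fun t => f t ^ 2) t.
Proof.
intros Hf. apply (continuous_ext (fun t => mult (f t) (f t))).
- intros y. change (f y * f y = f y ^ 2). ring.
- now apply (continuous_mult f f).
Qed.

Lemma ex_RInt_sq (f : R -> R) (a b : R) :
  (forall t, continuous f t) -> ex_RInt (fun t => f t ^ 2) a b.
Proof.
intros Hf. apply (ex_RInt_continuous (fun t => f t ^ 2)).
intros t _. now apply continuous_sq.
Qed.

Lemma is_RInt_exp_affine (g p a b : R) : g <> 0 ->
  is_RInt (fun t => exp (g * (t - p))) a b
    (exp (g * (b - p)) / g - exp (g * (a - p)) / g).
Proof.
intros Hg.
apply (is_RInt_derive (fun t => exp (g * (t - p)) / g)).
- intros t _. auto_derive; [exact I |]. unfold one, plus, mult, Rminus; simpl. now field.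
- intros t _. apply (ex_derive_continuous (fun t => exp (g * (t - p)))).
  now auto_derive.
Qed.

Lemma RInt_sq_le_forward (f : R -> R) (a b c beta : R) :
  0 < beta -> a <= b ->
  ex_RInt (fun t => f t ^ 2) a b ->
  (forall t, a <= t <= b -> 0 <= f t <= c * exp (- beta * (t - a))) ->
  RInt (fun t => f t ^ 2) a b <= c ^ 2 / (2 * beta).
Proof.
intros Hb Hab Hex Hf.
pose proof (is_RInt_exp_affine (- (2 * beta)) a a b ltac:(lra)) as HI.
apply (is_RInt_scal _ _ _ (c ^ 2)) in HI.
apply Rle_trans with
  (c ^ 2 * (exp (- (2 * beta) * (b - a)) / - (2 * beta)
            - exp (- (2 * beta) * (a - a)) / - (2 * beta))).
- refine (is_RInt_le _ _ _ _ _ _ Hab (RInt_correct _ _ _ Hex) HI _).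
  intros t Ht. destruct (Hf t) as [H0 H1]; [lra |].
  change (f t ^ 2 <= c ^ 2 * exp (- (2 * beta) * (t - a))).
  replace (- (2 * beta) * (t - a)) with (- beta * (t - a) + - beta * (t - a)) by ring.
  rewrite exp_plus.
  replace (c ^ 2 * _) with ((c * exp (- beta * (t - a))) ^ 2) by ring.
  apply pow_incr; lra.
- rewrite Rminus_diag, Rmult_0_r, exp_0.
  pose proof (exp_pos (- (2 * beta) * (b - a))) as He.
  set (e := exp _) in *.
  assert (0 <= c ^ 2 / (2 * beta) * e).
  { apply Rmult_le_pos; [| lra]. apply Rdiv_le_0_compat; [apply pow2_ge_0 | lra]. }
  replace (c ^ 2 * (e / - (2 * beta) - 1 / - (2 * beta)))
    with (c ^ 2 / (2 * beta) - c ^ 2 / (2 * beta) * e) by (field; lra).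
  lra.
Qed.

Lemma RInt_reflect (f : R -> R) (a b c : R) :
  ex_RInt f (c - b) (c - a) ->
  ex_RInt (fun t => f (c - t)) a b /\
  RInt (fun t => f (c - t)) a b = RInt f (c - b) (c - a).
Proof.
intros Hf.
assert (H : is_RInt (fun t => f (c - t)) a b (RInt f (c - b) (c - a))).
{ pose proof (RInt_correct f _ _ Hf) as HI.
  set (I := RInt f (c - b) (c - a)) in *.
  apply is_RInt_swap in HI.
  replace (c - b) with (-1 * b + c) in HI by ring.
  replace (c - a) with (-1 * a + c) in HI by ring.
  apply is_RInt_comp_lin, is_RInt_opp in HI.
  rewrite opp_opp in HI.
  revert HI; apply is_RInt_ext. intros t _.
  change (- (-1 * f (-1 * t + c)) = f (c - t)).
  replace (-1 * t + c) with (c - t) by ring. ring. }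
split; [eexists; exact H | now apply is_RInt_unique].
Qed.

(** The mirror image of [RInt_sq_le_forward] under t -> a + b - t. *)
Lemma RInt_sq_le_backward (f : R -> R) (a b c beta : R) :
  0 < beta -> a <= b ->
  ex_RInt (fun t => f t ^ 2) a b ->
  (forall t, a <= t <= b -> 0 <= f t <= c * exp (- beta * (b - t))) ->
  RInt (fun t => f t ^ 2) a b <= c ^ 2 / (2 * beta).
Proof.
intros Hb Hab Hex Hf.
destruct (RInt_reflect (fun t => f t ^ 2) a b (a + b)) as [Hex' Heq].
{ now replace (a + b - b) with a by ring; replace (a + b - a) with b by ring. }
replace (a + b - b) with a in Heq by ring.
replace (a + b - a) with b in Heq by ring.
rewrite <- Heq.
apply (RInt_sq_le_forward (fun t => f (a + b - t))); auto.
intros t Ht. replace (t - a) with (b - (a + b - t)) by ring. apply Hf; lra.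
Qed.

(** * Datko's argument for one scalar orbit *)

(** One constant serves both short and long time intervals: the factor exp(omega)
    pays for the growth over a unit of time, and the extra exp(1) for the
    exponential decay that is not yet available during that unit. *)
Definition datko_const (M omega k : R) : R := M * k * exp (omega + 1).

Lemma datko_const_ge_1 (M omega k : R) :
  1 <= M -> 0 < omega -> 1 <= k -> 1 <= datko_const M omega k.
Proof.
intros HM Ho Hk. unfold datko_const.
pose proof (exp_ineq1_le (omega + 1)).
assert (1 <= M * k) by nra. nra.
Qed.

(** A Gronwall argument: with Phi(s) the integral of u^2 over [s,b], the
    hypothesis reads Phi <= - k Phi', so exp((s - a)/k) Phi(s) is nonincreasing. *)
Lemma tail_integral_decay (u : R -> R) (a b k : R) :
  (forall t, continuous u t) -> 0 < k ->
  (forall s, a <= s <= b -> RInt (fun t => u t ^ 2) s b <= k * u s ^ 2) ->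
  forall s, a <= s <= b ->
    RInt (fun t => u t ^ 2) s b <= k * exp (- (s - a) / k) * u a ^ 2.
Proof.
intros Hc Hk Hu s Hs.
assert (Hc2 : forall t, continuous (fun t => u t ^ 2) t).
{ intros t. now apply continuous_sq. }
set (Phi := fun s : R => RInt (fun t => u t ^ 2) s b : R).
set (F := fun s : R => Phi s * exp ((s - a) / k)).
assert (HF : forall t, is_derive F t ((Phi t / k - u t ^ 2) * exp ((t - a) / k))).
{ intros t.
  assert (HPhi : is_derive Phi t (- (u t ^ 2))).
  { apply (is_derive_RInt' (fun t => u t ^ 2) Phi t b); [| apply Hc2].
    exists (mkposreal 1 Rlt_0_1). intros r _. exact (RInt_correct _ _ _ (ex_RInt_sq u r b Hc)). }
  unfold F. 
  evar_last.
  - apply (is_derive_mult Phi (fun s => exp ((s - a) / k)) t (- (u t ^ 2))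
      (exp ((t - a) / k) / k)); [exact HPhi | | intros; apply Rmult_comm].
    auto_derive; [exact I |]. unfold Rminus, Rdiv. ring.
  - change (- u t ^ 2 * exp ((t - a) / k) + Phi t * (exp ((t - a) / k) / k)
      = (Phi t / k - u t ^ 2) * exp ((t - a) / k)). field. lra. }
assert (HFs : F s <= F a).
{ destruct (MVT_gen F a s _ (fun x _ => HF x)) as [c [Hca Hceq]].
  - intros x _. apply continuity_pt_filterlim.
    apply (ex_derive_continuous F). eexists; apply HF.
  - rewrite Rmin_left, Rmax_right in Hca by lra.
    assert (Phi c / k <= u c ^ 2).
    { apply Rle_div_l; [lra |]. rewrite Rmult_comm. apply Hu. lra. }
    pose proof (exp_pos ((c - a) / k)).
    assert (0 <= (u c ^ 2 - Phi c / k) * exp ((c - a) / k) * (s - a)).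
    { apply Rmult_le_pos; [apply Rmult_le_pos |]; lra. }
    lra. }
unfold F in HFs at 2. replace ((a - a) / k) with 0 in HFs by (field; lra).
rewrite exp_0, Rmult_1_r in HFs.
assert (Ha : Phi a <= k * u a ^ 2) by (apply Hu; lra).
unfold F in HFs.
replace (RInt (fun t => u t ^ 2) s b)
  with (Phi s * exp ((s - a) / k) * exp (- (s - a) / k)).
- replace (k * exp (- (s - a) / k) * u a ^ 2)
    with (k * u a ^ 2 * exp (- (s - a) / k)) by ring.
  apply Rmult_le_compat_r; [apply Rlt_le, exp_pos | lra].
- rewrite Rmult_assoc, <- exp_plus.
  replace ((s - a) / k + - (s - a) / k) with 0 by (field; lra).
  rewrite exp_0. unfold Phi. ring.
Qed.

(** If b - a <= 1, growth alone suffices.  Otherwise growth bounds u(b) by the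
    values of u on the last unit interval [b-1,b], hence u(b)^2 by the tail
    integral from b - 1, which decays exponentially. *)
Lemma datko_forward (u : R -> R) (a b M omega k : R) :
  (forall t, continuous u t) -> (forall t, 0 <= u t) ->
  a <= b -> 1 <= M -> 0 < omega -> 1 <= k ->
  (forall s, a <= s <= b -> RInt (fun t => u t ^ 2) s b <= k * u s ^ 2) ->
  (forall s, a <= s <= b -> u b <= M * exp (omega * (b - s)) * u s) ->
  u b <= datko_const M omega k * exp (- (/ (2 * k)) * (b - a)) * u a.
Proof.
intros Hc Hpos Hab HM Ho Hk Hint Hgrow.
assert (Hik : 0 < / (2 * k) <= 1 / 2).
{ split; [apply Rinv_0_lt_compat; lra |].
  apply Rle_trans with (/ 2); [apply Rinv_le_contravar; lra | lra]. }
assert (He2 : forall x, exp (2 * x) = exp x ^ 2).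
{ intros x. replace (2 * x) with (x + x) by ring. rewrite exp_plus; ring. }
destruct (Rle_lt_dec (b - a) 1) as [Hd | Hd].
- eapply Rle_trans; [apply (Hgrow a); lra |].
  apply Rmult_le_compat_r; [apply Hpos |].
  unfold datko_const. rewrite Rmult_assoc, <- exp_plus.
  apply Rle_trans with (M * exp (omega + 1 + - / (2 * k) * (b - a))).
  + apply Rmult_le_compat_l; [lra |]. apply exp_monotone. nra.
  + apply Rmult_le_compat_r; [apply Rlt_le, exp_pos | nra].
- assert (Hlast : u b ^ 2 <= (M * exp omega) ^ 2 * RInt (fun t => u t ^ 2) (b - 1) b).
  { assert (Hex : ex_RInt (fun t => u t ^ 2) (b - 1) b)
      by now apply ex_RInt_sq.
    refine (is_RInt_le (fun _ => u b ^ 2)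
      (fun t => (M * exp omega) ^ 2 * u t ^ 2) (b - 1) b _ _ ltac:(lra) _
      (is_RInt_scal _ _ _ _ _ (RInt_correct _ _ _ Hex)) _).
    { evar_last; [apply is_RInt_const |].
      change ((b - (b - 1)) * u b ^ 2 = u b ^ 2). ring. }
    intros t Ht. rewrite <- Rpow_mult_distr.
    apply pow_incr. split; [apply Hpos |].
    eapply Rle_trans; [apply (Hgrow t); lra |].
    apply Rmult_le_compat_r; [apply Hpos |].
    apply Rmult_le_compat_l; [lra |]. apply exp_monotone. nra. }
  assert (Htail := tail_integral_decay u a b k Hc ltac:(lra) Hint (b - 1) ltac:(lra)).
  set (N := datko_const M omega k).
  assert (HN : 0 <= N * exp (- / (2 * k) * (b - a)) * u a).
  { apply Rmult_le_pos; [| apply Hpos]. apply Rmult_le_pos; [| apply Rlt_le, exp_pos].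
    pose proof (datko_const_ge_1 M omega k HM Ho Hk). unfold N; lra. }
  apply Rsqr_incr_0; [| apply Hpos | exact HN].
  rewrite !Rsqr_pow2.
  eapply Rle_trans; [exact Hlast |].
  eapply Rle_trans; [apply Rmult_le_compat_l; [apply pow2_ge_0 | exact Htail] |].
  rewrite !Rpow_mult_distr, <- Rmult_assoc.
  apply Rmult_le_compat_r; [apply pow2_ge_0 |].
  unfold N, datko_const. rewrite !Rpow_mult_distr, <- !He2.
  (* Starting the tail at b - 1 instead of b costs exp(1/k), at most exp(2). *)
  assert (Hexp : exp (- (b - 1 - a) / k) <= exp 2 * exp (2 * (- / (2 * k) * (b - a)))).
  { rewrite <- exp_plus. apply exp_monotone.
    replace (- (b - 1 - a) / k)
      with (2 * / (2 * k) + 2 * (- / (2 * k) * (b - a))) by (field; lra). lra. }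
  replace (2 * (omega + 1)) with (2 * omega + 2) by ring. rewrite (exp_plus (2 * omega)).
  replace (M ^ 2 * exp (2 * omega) * (k * exp (- (b - 1 - a) / k)))
    with ((M ^ 2 * exp (2 * omega)) * k * exp (- (b - 1 - a) / k)) by ring.
  replace (M ^ 2 * k ^ 2 * (exp (2 * omega) * exp 2) * exp (2 * (- / (2 * k) * (b - a))))
    with ((M ^ 2 * exp (2 * omega)) * k ^ 2 *
      (exp 2 * exp (2 * (- / (2 * k) * (b - a))))) by ring.
  assert (0 <= M ^ 2 * exp (2 * omega)).
  { apply Rmult_le_pos; [apply pow2_ge_0 | apply Rlt_le, exp_pos]. }
  apply Rmult_le_compat; [apply Rmult_le_pos; lra | apply Rlt_le, exp_pos | | exact Hexp].
  apply Rmult_le_compat_l; [assumption | nra].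
Qed.

Lemma datko_backward (w : R -> R) (a b M omega k : R) :
  (forall t, continuous w t) -> (forall t, 0 <= w t) ->
  a <= b -> 1 <= M -> 0 < omega -> 1 <= k ->
  (forall s, a <= s <= b -> RInt (fun t => w t ^ 2) a s <= k * w s ^ 2) ->
  (forall s, a <= s <= b -> w a <= M * exp (omega * (s - a)) * w s) ->
  w a <= datko_const M omega k * exp (- (/ (2 * k)) * (b - a)) * w b.
Proof.
intros Hc Hpos Hab HM Ho Hk Hint Hgrow.
set (u := fun t => w (a + b - t)).
assert (Hua : u a = w b) by (unfold u; f_equal; ring).
assert (Hub : u b = w a) by (unfold u; f_equal; ring).
rewrite <- Hua, <- Hub. apply datko_forward; auto.
- intros t. apply (continuous_comp (fun t => a + b - t) w); [| apply Hc].
  apply (ex_derive_continuous (fun t => a + b - t)). now auto_derive.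
- intros t; apply Hpos.
- intros s Hs.
  assert (Hex : ex_RInt (fun t => w t ^ 2) (a + b - b) (a + b - s))
    by now apply ex_RInt_sq.
  destruct (RInt_reflect _ _ _ _ Hex) as [_ Heq].
  unfold u. rewrite Heq. replace (a + b - b) with a by ring. apply Hint; lra.
- intros s Hs. rewrite Hub. unfold u.
  replace (b - s) with (a + b - s - a) by ring. apply Hgrow; lra.
Qed.

(** * Operator norms and pointwise bounds *)

(** The two scalar fields enter the proof only through the existence of scalars
    of every positive modulus, which normalise vectors. *)
Lemma scalar_of_modulus (K : AbsRing) (hK : K = R_AbsRing \/ K = C_AbsRing) (r : R) :
  0 < r ->
  exists a b : K, mult a b = one /\ abs a <= r /\ abs b <= / r.
Proof.
intros Hr. assert (Hir := Rinv_0_lt_compat _ Hr).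
destruct hK as [-> | ->].
- exists r, (/ r). split; [apply Rinv_r; lra |].
  split; apply Req_le, Rabs_pos_eq; lra.
- exists (RtoC r), (RtoC (/ r)).
  split.
  { change (Cmult (RtoC r) (RtoC (/ r)) = RtoC 1).
    rewrite <- RtoC_mult, Rinv_r by lra. reflexivity. }
  split; change (Cmod (RtoC r) <= r) || change (Cmod (RtoC (/ r)) <= / r);
    rewrite Cmod_R; apply Req_le, Rabs_pos_eq; lra.
Qed.

(** Homogeneity carries the bound from the unit ball to every vector.  It is the
    form of linearity that is easy to check for V(s,t)Q(t), which is defined by
    description. *)
Lemma op_norm_le_iff (K : AbsRing) (hK : K = R_AbsRing \/ K = C_AbsRing)
    (X Y : NormedModule K) (T : X -> Y) (c : R) :
  (forall (l : K) (x : X), T (scal l x) = scal l (T x)) -> 0 <= c ->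
  (Rbar_le (op_norm T) c <-> forall x, norm (T x) <= c * norm x).
Proof.
intros Hom Hc.
destruct (Lub_Rbar_correct (fun r => exists x : X, norm x <= 1 /\ r = norm (T x)))
  as [Hub Hleast].
fold (op_norm T) in Hub, Hleast. split.
- intros Hle x.
  assert (Hball : forall y, norm y <= 1 -> norm (T y) <= c).
  { intros y Hy.
    apply (Rbar_le_trans (norm (T y)) (op_norm T) c); [| exact Hle].
    apply Hub. now exists y. }
  destruct (Rle_lt_or_eq_dec 0 (norm x) (norm_ge_0 x)) as [Hx | Hx].
  + destruct (scalar_of_modulus K hK (norm x) Hx) as [a [b [Hab [Ha Hb]]]].
    assert (Hy : norm (scal b x) <= 1).
    { eapply Rle_trans; [apply norm_scal |].
      rewrite <- (Rinv_l (norm x)) by lra. apply Rmult_le_compat_r; lra. }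
    replace x with (scal a (scal b x)) at 1
      by (rewrite scal_assoc, Hab; apply scal_one).
    rewrite Hom. eapply Rle_trans; [apply norm_scal |].
    rewrite Rmult_comm.
    apply Rmult_le_compat; auto using norm_ge_0, abs_ge_0.
  + symmetry in Hx. rewrite Hx. apply norm_eq_zero in Hx. subst x.
    assert (HT : T zero = zero).
    { transitivity (T (scal zero zero)).
      - f_equal. symmetry.
        exact (@scal_zero_l K (NormedModule.ModuleSpace K X) zero).
      - rewrite Hom.
        exact (@scal_zero_l K (NormedModule.ModuleSpace K Y) (T zero)). }
    rewrite HT, norm_zero. lra.
- intros Hb. apply Hleast. intros r [x [Hx ->]]. simpl.
  eapply Rle_trans; [apply Hb |]. nra.
Qed.

Lemma linear_minus (K : AbsRing) (X Y : NormedModule K) (T : X -> Y) (x y : X) :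
  is_linear T -> T (minus x y) = minus (T x) (T y).
Proof.
intros HT. unfold minus. rewrite (linear_plus T HT).
f_equal. exact (linear_opp T y HT).
Qed.

(** A bounded non-empty set of reals has a finite supremum, so no information is
    lost when the extended real supremum is cast to a real. *)
Lemma real_Lub_Rbar_correct (E : R -> Prop) (e0 B : R) :
  E e0 -> (forall r, E r -> r <= B) ->
  (forall r, E r -> r <= real (Lub_Rbar E)) /\
  (forall b, (forall r, E r -> r <= b) -> real (Lub_Rbar E) <= b).
Proof.
intros He0 HB. destruct (Lub_Rbar_correct E) as [Hub Hleast].
assert (H0 := Hub e0 He0). assert (H1 := Hleast (Finite B) HB).
destruct (Lub_Rbar E) as [l | |]; simpl in *; try contradiction.
split; [exact Hub |]. intros b Hb. now apply (Hleast (Finite b)).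
Qed.

(** * Compatible projections and the backward maps V *)

Section Evolution.

Context {K : AbsRing} {X : CompleteNormedModule K}.
Context {U : R -> R -> X -> X} {P : R -> X -> X}.
Context (hU : evolution_operator U) (hP : projection_valued P)
  (hUP : compatible U P).

Notation Q := (compl_proj P).
Notation V := (kernel_inverse U P).

Lemma compl_proj_kernel (t : R) (x : X) : 0 <= t -> kernel (P t) (Q t x).
Proof.
intros Ht. unfold kernel, compl_proj.
rewrite (linear_minus _ _ _ (P t) _ _ (proj_bounded_linear hP Ht)).
rewrite (proj_idem hP) by assumption.
exact (@minus_eq_zero X (P t x)).
Qed.

Lemma compl_proj_of_kernel (t : R) (x : X) : kernel (P t) x -> Q t x = x.
Proof.
intros Hx. unfold compl_proj. rewrite Hx. exact (@minus_zero_r X x).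
Qed.

Lemma compl_proj_of_range (t : R) (x : X) : 0 <= t -> Q t (P t x) = zero.
Proof.
intros Ht. unfold compl_proj. rewrite (proj_idem hP) by assumption.
exact (@minus_eq_zero X (P t x)).
Qed.

Lemma proj_plus_compl (t : R) (x : X) : plus (P t x) (Q t x) = x.
Proof.
unfold compl_proj, minus.
etransitivity; [exact (@plus_comm X _ _) |].
etransitivity; [symmetry; exact (@plus_assoc X _ _ _) |].
rewrite (@plus_opp_l X). exact (@plus_zero_r X x).
Qed.

Lemma compl_proj_scal (t : R) (l : K) (x : X) :
  0 <= t -> Q t (scal l x) = scal l (Q t x).
Proof.
intros Ht. unfold compl_proj.
rewrite (linear_scal (P t) (proj_bounded_linear hP Ht)).
symmetry. exact (@scal_minus_distr_l K X l x (P t x)).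
Qed.

Lemma evo_linear (t s : R) : 0 <= s <= t -> is_linear (U t s).
Proof. apply (evo_bounded_linear hU). Qed.

Lemma evo_zero (t s : R) : 0 <= s <= t -> U t s zero = zero.
Proof. intros Hts. exact (linear_zero _ (evo_linear t s Hts)). Qed.

Lemma evo_kernel (t s : R) (x : X) :
  0 <= s <= t -> kernel (P s) x -> kernel (P t) (U t s x).
Proof. intros Hts. apply (hUP t s Hts). Qed.

Lemma evo_compl_proj (t s : R) (x : X) :
  0 <= s <= t -> Q t (U t s x) = U t s (Q s x).
Proof.
intros Hts. unfold compl_proj.
rewrite (proj1 (hUP t s Hts)).
symmetry. exact (linear_minus _ _ _ _ _ _ (evo_linear t s Hts)).
Qed.

Lemma kernel_inverse_spec (t s : R) (y : X) :
  0 <= s <= t -> kernel (P t) y ->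
  kernel (P s) (V s t y) /\ U t s (V s t y) = y.
Proof.
intros Hts Hy.
apply (iota_correct (fun x => kernel (P s) x /\ U t s x = y)).
apply (hUP t s Hts), Hy.
Qed.

Lemma kernel_inverse_eq (t s : R) (z : X) :
  0 <= s <= t -> kernel (P s) z -> V s t (U t s z) = z.
Proof.
intros Hts Hz. assert (Hy := evo_kernel t s z Hts Hz).
destruct (hUP t s Hts) as [_ [_ [Huniq _]]].
destruct (Huniq _ Hy) as [w [_ Hw]].
rewrite <- (Hw (V s t (U t s z))), <- (Hw z); auto.
now apply kernel_inverse_spec.
Qed.

Lemma kernel_scal (t : R) (l : K) (x : X) :
  0 <= t -> kernel (P t) x -> kernel (P t) (scal l x).
Proof.
unfold kernel. intros Ht Hx.
now rewrite (linear_scal _ (proj_bounded_linear hP Ht)), Hx, (@scal_zero_r K X).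
Qed.

Lemma kernel_inverse_scal (t s : R) (l : K) (y : X) :
  0 <= s <= t -> kernel (P t) y -> V s t (scal l y) = scal l (V s t y).
Proof.
intros Hts Hy. destruct (kernel_inverse_spec t s y Hts Hy) as [Hz HUz].
rewrite <- HUz at 1. rewrite <- (linear_scal _ (evo_linear t s Hts)).
apply kernel_inverse_eq; auto. apply kernel_scal; auto; lra.
Qed.

Lemma kernel_zero (t : R) : 0 <= t -> kernel (P t) zero.
Proof. intros Ht. apply (linear_zero _ (proj_bounded_linear hP Ht)). Qed.

Lemma kernel_inverse_zero (t s : R) : 0 <= s <= t -> V s t zero = zero.
Proof.
intros Hts. rewrite <- (evo_zero t s Hts) at 1.
apply kernel_inverse_eq; auto. apply kernel_zero; lra.
Qed.

(** On kernels, V(r,t) = U(r,s)V(s,t): the backward orbit of y is a genuine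
    forward orbit started at time s, so its regularity comes from that of U. *)
Lemma evo_kernel_inverse (t r s : R) (y : X) :
  0 <= s <= r -> r <= t -> kernel (P t) y -> U r s (V s t y) = V r t y.
Proof.
intros Hsr Hrt Hy.
destruct (kernel_inverse_spec t s y) as [Hz HUz]; [lra | exact Hy |].
rewrite <- HUz at 2. rewrite <- (evo_comp hU _ (t := t) (s := r)) by lra.
symmetry; apply kernel_inverse_eq; [lra |]. now apply evo_kernel.
Qed.

Lemma op_norm_pair_iff (hK : K = R_AbsRing \/ K = C_AbsRing) (t s c : R) :
  0 <= s <= t -> 0 <= c ->
  (Rbar_le (op_norm (fun x => U t s (P s x))) c /\
   Rbar_le (op_norm (fun x => V s t (Q t x))) c) <->
  (forall x, norm (U t s (P s x)) <= c * norm x /\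
             norm (V s t (Q t x)) <= c * norm x).
Proof.
intros Hts Hc.
rewrite (op_norm_le_iff K hK X X (fun x => U t s (P s x))); [| | exact Hc].
2:{ intros l x. rewrite (linear_scal _ (proj_bounded_linear hP (proj1 Hts))).
    apply (linear_scal _ (evo_linear t s Hts)). }
rewrite (op_norm_le_iff K hK X X (fun x => V s t (Q t x))); [| | exact Hc].
2:{ intros l x. rewrite compl_proj_scal by lra.
    apply kernel_inverse_scal; [exact Hts | apply compl_proj_kernel; lra]. }
split.
- intros [H1 H2] x. auto.
- intros H. split; intros x; apply H.
Qed.

(** * Energy of an orbit *)

(** Freezing the time at s to the left of s makes the norm along an orbit
    continuous on the whole line, which spares one-sided continuity at s. *)
Definition orbit_norm (s : R) (x : X) (tau : R) : R := norm (U (Rmax s tau) s x).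

Lemma orbit_norm_eq (s tau : R) (x : X) :
  s <= tau -> orbit_norm s x tau = norm (U tau s x).
Proof. intros H. unfold orbit_norm. now rewrite Rmax_right. Qed.

Lemma orbit_norm_continuous (s : R) (x : X) (tau : R) :
  0 <= s -> continuous (orbit_norm s x) tau.
Proof.
intros Hs. unfold continuous, orbit_norm.
eapply filterlim_comp; [| apply filterlim_norm].
apply (filterlim_comp _ _ _ (fun r => (Rmax s r, s))
  (fun p => U (fst p) (snd p) x) _
  (within (fun p : R * R => 0 <= snd p <= fst p) (locally (Rmax s tau, s)))).
- intros A [eps HA]. exists eps. intros r Hr.
  apply HA.
  + split; [| apply ball_center]. simpl.
    unfold ball in *; simpl in *. unfold AbsRing_ball, abs, minus, plus, opp in *; simpl in *.
    eapply Rle_lt_trans; [| exact Hr].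
    unfold Rmax, Rabs.
    repeat destruct Rle_dec; repeat destruct Rcase_abs; lra.
  + simpl. split; [exact Hs | apply Rmax_l].
- refine (evo_continuous hU x _). simpl. split; [exact Hs | apply Rmax_l].
Qed.

Definition energy (s : R) (x : X) (a b : R) : R :=
  RInt (fun tau => norm (U tau s x) ^ 2) a b.

Lemma energy_orbit_norm (s : R) (x : X) (a b : R) :
  s <= a <= b -> energy s x a b = RInt (fun tau => orbit_norm s x tau ^ 2) a b.
Proof.
intros Hab. apply RInt_ext. intros tau.
rewrite Rmin_left, Rmax_right by lra. intros Htau.
now rewrite orbit_norm_eq by lra.
Qed.

Lemma ex_energy (s : R) (x : X) (a b : R) :
  0 <= s <= a -> a <= b -> ex_RInt (fun tau => norm (U tau s x) ^ 2) a b.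
Proof.
intros Hs Hab.
apply (ex_RInt_ext (fun tau => orbit_norm s x tau ^ 2)).
- intros tau. rewrite Rmin_left, Rmax_right by lra. intros Htau.
  now rewrite orbit_norm_eq by lra.
- apply ex_RInt_sq. intros tau. apply orbit_norm_continuous; lra.
Qed.

Lemma energy_Chasles (s : R) (x : X) (a b c : R) :
  0 <= s <= a -> a <= b -> b <= c ->
  energy s x a b + energy s x b c = energy s x a c.
Proof.
intros Hs Hab Hbc.
apply (RInt_Chasles (fun tau => norm (U tau s x) ^ 2) a b c);
  apply ex_energy; lra.
Qed.

Lemma energy_shift (r s a b : R) (x : X) :
  0 <= s <= r -> r <= a <= b ->
  energy r (U r s x) a b = energy s x a b.
Proof.
intros Hsr Hab. apply RInt_ext. intros tau.
rewrite Rmin_left, Rmax_right by lra. intros Htau.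
now rewrite (evo_comp hU) by lra.
Qed.

Lemma energy_ge_0 (s : R) (x : X) (a b : R) :
  0 <= s <= a -> a <= b -> 0 <= energy s x a b.
Proof.
intros Hs Hab. apply RInt_ge_0; [lra | now apply ex_energy |].
intros tau _. apply pow2_ge_0.
Qed.

Lemma energy_zero (s a b : R) : 0 <= s <= a -> a <= b -> energy s zero a b = 0.
Proof.
intros Hs Hab.
transitivity (RInt (fun _ => 0) a b).
- apply RInt_ext. intros tau. rewrite Rmin_left, Rmax_right by lra. intros Htau.
  assert (H0 : norm (U tau s zero) = 0).
  { etransitivity; [| apply (@norm_zero K X)].
    f_equal. apply evo_zero; lra. }
  rewrite H0. change (0 ^ 2 = 0). ring.
- apply is_RInt_unique. evar_last; [apply (is_RInt_const a b 0) |].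
  apply Rmult_0_r.
Qed.

Lemma energy_split (s t : R) (x : X) :
  0 <= s <= t ->
  energy s x s t <= 2 * energy s (P s x) s t + 2 * energy s (Q s x) s t.
Proof.
intros Hst.
assert (H1 := ex_energy s (P s x) s t ltac:(lra) ltac:(lra)).
assert (H2 := ex_energy s (Q s x) s t ltac:(lra) ltac:(lra)).
refine (is_RInt_le _ _ s t _ _ ltac:(lra)
  (RInt_correct _ _ _ (ex_energy s x s t ltac:(lra) ltac:(lra)))
  (is_RInt_plus _ _ _ _ _ _ (is_RInt_scal _ _ _ 2 _ (RInt_correct _ _ _ H1))
     (is_RInt_scal _ _ _ 2 _ (RInt_correct _ _ _ H2))) _).
intros tau Htau.
change (norm (U tau s x) ^ 2 <=
  2 * norm (U tau s (P s x)) ^ 2 + 2 * norm (U tau s (Q s x)) ^ 2).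
rewrite <- (proj_plus_compl s x) at 1.
rewrite (linear_plus _ (evo_linear tau s ltac:(lra))).
pose proof (norm_triangle (U tau s (P s x)) (U tau s (Q s x))) as Htri.
pose proof (norm_ge_0 (plus (U tau s (P s x)) (U tau s (Q s x)))) as Hpos.
set (p := norm (U tau s (P s x))) in *. set (q := norm (U tau s (Q s x))) in *.
apply Rle_trans with ((p + q) ^ 2).
- apply pow_incr. split; assumption.
- pose proof (pow2_ge_0 (p - q)). lra.
Qed.

(** * The Lyapunov function of a dichotomy *)

(** The improper integral of |U(tau,s)x|^2 over [s,oo), as the supremum of its
    partial integrals: for a nonnegative integrand the two agree, and bounds on
    a supremum need no convergence argument. *)
Definition tail_energy (s : R) (x : X) : R :=
  real (Lub_Rbar (fun r => exists t, s <= t /\ r = energy s x s t)).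

Lemma tail_energy_bounds (s : R) (x : X) (B : R) :
  (forall t, s <= t -> energy s x s t <= B) ->
  (forall t, s <= t -> energy s x s t <= tail_energy s x) /\
  (forall b, (forall t, s <= t -> energy s x s t <= b) -> tail_energy s x <= b).
Proof.
intros HB.
destruct (real_Lub_Rbar_correct (fun r => exists t, s <= t /\ r = energy s x s t)
  (energy s x s s) B) as [Hub Hleast].
- exists s. split; [apply Rle_refl | reflexivity].
- intros r [t [Ht ->]]. auto.
- split.
  + intros t Ht. apply Hub. now exists t.
  + intros b Hb. apply Hleast. intros r [t [Ht ->]]. auto.
Qed.

(** The integral of |V(tau,t)y|^2 over [0,t] for y in the kernel of P(t), written
    as the energy of the orbit that starts at time 0 and reaches y at time t
    (see [evo_kernel_inverse]). *)
Definition past_energy (t : R) (y : X) : R := energy 0 (V 0 t y) 0 t.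

Definition lyapunov (t : R) (x : X) : R :=
  2 * tail_energy t (P t x) - 2 * past_energy t (Q t x).

(** The orbits through y at time s and through U(t,s)y at time t have the same
    starting point at time 0, by injectivity of U(t,0) on the kernel. *)
Lemma past_energy_evo (t s : R) (y : X) :
  0 <= s <= t -> kernel (P s) y ->
  past_energy t (U t s y) = past_energy s y + energy s y s t.
Proof.
intros Hst Hy. unfold past_energy.
destruct (kernel_inverse_spec s 0 y ltac:(lra) Hy) as [Hz HUz].
set (z := V 0 s y) in *.
rewrite <- HUz, (evo_comp hU) by lra.
rewrite kernel_inverse_eq by (lra || exact Hz).
rewrite energy_shift by lra.
symmetry. apply energy_Chasles; lra.
Qed.

Section LyapunovOfDichotomy.

Context {N beta : R} (hbeta : 0 < beta).
Context (hdich : forall t s x, 0 <= s <= t ->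
  norm (U t s (P s x)) <= N * exp (- beta * (t - s)) * norm x /\
  norm (V s t (Q t x)) <= N * exp (- beta * (t - s)) * norm x).

Lemma energy_stable_le (t s : R) (x : X) :
  0 <= s <= t -> energy s (P s x) s t <= N ^ 2 / (2 * beta) * norm x ^ 2.
Proof.
intros Hst.
replace (N ^ 2 / (2 * beta) * norm x ^ 2)
  with ((N * norm x) ^ 2 / (2 * beta)) by (field; lra).
apply RInt_sq_le_forward; [lra | lra | apply ex_energy; lra |].
intros tau Htau. split; [apply norm_ge_0 |].
replace (N * norm x * exp (- beta * (tau - s)))
  with (N * exp (- beta * (tau - s)) * norm x) by ring.
apply hdich; lra.
Qed.

Lemma past_energy_le (t : R) (x : X) :
  0 <= t -> past_energy t (Q t x) <= N ^ 2 / (2 * beta) * norm x ^ 2.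
Proof.
intros Ht.
replace (N ^ 2 / (2 * beta) * norm x ^ 2)
  with ((N * norm x) ^ 2 / (2 * beta)) by (field; lra).
apply RInt_sq_le_backward; [lra | lra | apply ex_energy; lra |].
intros tau Htau. split; [apply norm_ge_0 |].
rewrite evo_kernel_inverse by (lra || now apply compl_proj_kernel).
replace (N * norm x * exp (- beta * (t - tau)))
  with (N * exp (- beta * (t - tau)) * norm x) by ring.
apply hdich; lra.
Qed.

Lemma tail_energy_ge (t s : R) (x : X) :
  0 <= s <= t -> energy s (P s x) s t <= tail_energy s (P s x).
Proof.
intros Hst.
apply (tail_energy_bounds s (P s x) (N ^ 2 / (2 * beta) * norm x ^ 2)); [| lra].
intros r Hr. apply energy_stable_le; lra.
Qed.

Lemma tail_energy_le (s B : R) (x : X) : 0 <= s ->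
  (forall t, s <= t -> energy s (P s x) s t <= B) -> tail_energy s (P s x) <= B.
Proof. intros Hs HB. now apply (tail_energy_bounds s (P s x) B). Qed.

(** A partial integral from t, completed by the piece over [s,t], is a partial
    integral from s. *)
Lemma tail_energy_evo (t s : R) (x : X) :
  0 <= s <= t ->
  tail_energy t (P t (U t s x)) + energy s (P s x) s t <= tail_energy s (P s x).
Proof.
intros Hst.
enough (tail_energy t (P t (U t s x))
  <= tail_energy s (P s x) - energy s (P s x) s t) by lra.
apply tail_energy_le; [lra |]. intros r Hr.
rewrite (proj1 (hUP t s Hst)), energy_shift by lra.
pose proof (energy_Chasles s (P s x) s t r ltac:(lra) ltac:(lra) Hr).
pose proof (tail_energy_ge r s x ltac:(lra)). lra.
Qed.

Lemma lyapunov_decrease (t s : R) (x : X) :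
  0 <= s <= t ->
  lyapunov t (U t s x) + energy s x s t <= lyapunov s x.
Proof.
intros Hst. unfold lyapunov.
rewrite evo_compl_proj, past_energy_evo
  by (assumption || (apply compl_proj_kernel; lra)).
pose proof (tail_energy_evo t s x Hst). pose proof (energy_split s t x Hst). lra.
Qed.

Lemma lyapunov_stable (t : R) (x : X) :
  0 <= t -> lyapunov t (P t x) = 2 * tail_energy t (P t x).
Proof.
intros Ht. unfold lyapunov, past_energy.
rewrite compl_proj_of_range, kernel_inverse_zero, energy_zero, (proj_idem hP) by lra.
ring.
Qed.

Lemma lyapunov_unstable (t : R) (x : X) :
  0 <= t -> lyapunov t (Q t x) = - (2 * past_energy t (Q t x)).
Proof.
intros Ht. unfold lyapunov.
assert (HQ := compl_proj_kernel t x Ht).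
rewrite (compl_proj_of_kernel _ _ HQ).
assert (Htail : tail_energy t (P t (Q t x)) = 0).
{ apply Rle_antisym.
  - apply tail_energy_le; [exact Ht |]. intros r Hr.
    rewrite HQ, energy_zero by lra. lra.
  - eapply Rle_trans; [| apply (tail_energy_ge t); lra]. apply energy_ge_0; lra. }
rewrite Htail. ring.
Qed.

Lemma lyapunov_bounds (t : R) (x : X) :
  0 <= t ->
  0 <= lyapunov t (P t x) /\ lyapunov t (Q t x) <= 0 /\
  lyapunov t (P t x) - lyapunov t (Q t x) <= 2 * N ^ 2 / beta * norm x ^ 2.
Proof.
intros Ht. rewrite lyapunov_stable, lyapunov_unstable by exact Ht.
pose proof (tail_energy_ge t t x ltac:(lra)).
pose proof (energy_ge_0 t (P t x) t t ltac:(lra) ltac:(lra)).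
assert (0 <= past_energy t (Q t x)) by (apply energy_ge_0; lra).
pose proof (past_energy_le t x Ht).
assert (tail_energy t (P t x) <= N ^ 2 / (2 * beta) * norm x ^ 2).
{ apply tail_energy_le; [exact Ht |]. intros r Hr. apply energy_stable_le; lra. }
split; [lra |]. split; [lra |].
replace (2 * N ^ 2 / beta * norm x ^ 2)
  with (4 * (N ^ 2 / (2 * beta) * norm x ^ 2)) by (field; lra).
lra.
Qed.

End LyapunovOfDichotomy.

(** * Dichotomy from a Lyapunov function *)

Section DichotomyOfLyapunov.

Context {M omega : R} (hM : 1 <= M) (homega : 0 < omega).
Context (hgrow : forall t s x, 0 <= s <= t ->
  norm (U t s (P s x)) <= M * exp (omega * (t - s)) * norm x /\
  norm (V s t (Q t x)) <= M * exp (omega * (t - s)) * norm x).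
Context {L : R -> X -> R} {k : R} (hk : 1 <= k).
Context (hL : forall t s x, 0 <= s <= t ->
  L t (U t s x) + energy s x s t <= L s x /\
  0 <= L t (P t x) /\ L t (Q t x) <= 0 /\
  L t (P t x) - L t (Q t x) <= k * norm x ^ 2).

(** The growth estimate at t = s, where U and V are the identity.  Datko's
    argument bounds orbits by |P(s)x| and |Q(t)x|; this converts them to |x|. *)
Lemma norm_proj_le (t : R) (x : X) :
  0 <= t -> norm (P t x) <= M * norm x /\ norm (Q t x) <= M * norm x.
Proof.
intros Ht.
destruct (hgrow t t x ltac:(lra)) as [HP HQ].
assert (HV : V t t (Q t x) = Q t x).
{ rewrite <- (evo_id hU (Q t x) Ht) at 1.
  apply kernel_inverse_eq; [lra | now apply compl_proj_kernel]. }
rewrite (evo_id hU _ Ht) in HP. rewrite HV in HQ.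
rewrite Rminus_diag, Rmult_0_r, exp_0, Rmult_1_r in HP, HQ. now split.
Qed.

(** L stays nonnegative along the orbit of y, so by (1) the energy cannot exceed
    the initial value L(s,y), which (3) and (4) bound. *)
Lemma stable_energy_bound (t s : R) (y : X) :
  0 <= s <= t -> P s y = y -> energy s y s t <= k * norm y ^ 2.
Proof.
intros Hst Hy.
destruct (hL t s y Hst) as [Hdec _].
destruct (hL s s y ltac:(lra)) as [_ [_ [Hneg Hbd]]].
destruct (hL t t (U t s y) ltac:(lra)) as [_ [Hpos _]].
rewrite (proj1 (hUP t s Hst)), Hy in Hpos. rewrite Hy in Hbd. lra.
Qed.

(** Here L starts at a nonpositive value, so by (1) the energy is at most
    - L(t,U(t,s)z), and (2) and (4) bound the latter at time t. *)
Lemma unstable_energy_bound (t s : R) (z : X) :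
  0 <= s <= t -> kernel (P s) z -> energy s z s t <= k * norm (U t s z) ^ 2.
Proof.
intros Hst Hz.
destruct (hL t s z Hst) as [Hdec _].
destruct (hL s s z ltac:(lra)) as [_ [_ [Hneg _]]].
destruct (hL t t (U t s z) ltac:(lra)) as [_ [Hpos [_ Hbd]]].
rewrite (compl_proj_of_kernel _ _ Hz) in Hneg.
rewrite (compl_proj_of_kernel _ _ (evo_kernel t s z Hst Hz)) in Hbd. lra.
Qed.

(** [datko_forward] along the orbit; its hypotheses at an intermediate time r are
    the energy and growth bounds for the orbit restarted at r, whose initial
    value is again in the range of P(r). *)
Lemma stable_decay (t s : R) (x : X) :
  0 <= s <= t ->
  norm (U t s (P s x)) <=
    datko_const M omega k * exp (- / (2 * k) * (t - s)) * norm (P s x).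
Proof.
intros Hst. set (y := P s x).
assert (Hy : P s y = y) by (apply (proj_idem hP); lra).
rewrite <- (orbit_norm_eq s t y) by lra.
replace (norm y) with (orbit_norm s y s)
  by (rewrite orbit_norm_eq, (evo_id hU) by lra; reflexivity).
apply datko_forward; try assumption; try lra.
- intros tau. apply orbit_norm_continuous; lra.
- intros tau. apply norm_ge_0.
- intros r Hr. rewrite <- energy_orbit_norm, orbit_norm_eq by lra.
  rewrite <- (energy_shift r s r t y) by lra.
  apply stable_energy_bound; [lra |].
  rewrite (proj1 (hUP r s ltac:(lra))). now rewrite Hy.
- intros r Hr. rewrite !orbit_norm_eq by lra.
  rewrite <- (evo_comp hU y (t := t) (s := r)) by lra.
  rewrite <- Hy at 1. rewrite <- (proj1 (hUP r s ltac:(lra))).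
  apply hgrow; lra.
Qed.

(** [datko_backward] along the orbit of z = V(s,t)Q(t)x: since
    z = V(s,r)Q(r)U(r,s)z, the growth bound on V controls z by every later point
    of its orbit. *)
Lemma unstable_decay (t s : R) (x : X) :
  0 <= s <= t ->
  norm (V s t (Q t x)) <=
    datko_const M omega k * exp (- / (2 * k) * (t - s)) * norm (Q t x).
Proof.
intros Hst.
destruct (kernel_inverse_spec t s (Q t x) Hst) as [Hz HUz];
  [apply compl_proj_kernel; lra |].
set (z := V s t (Q t x)) in *.
rewrite <- HUz, <- (orbit_norm_eq s t z) by lra.
replace (norm z) with (orbit_norm s z s)
  by (rewrite orbit_norm_eq, (evo_id hU) by lra; reflexivity).
apply datko_backward; try assumption; try lra.
- intros tau. apply orbit_norm_continuous; lra.
- intros tau. apply norm_ge_0.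
- intros r Hr. rewrite <- energy_orbit_norm, orbit_norm_eq by lra.
  apply unstable_energy_bound; [lra | exact Hz].
- intros r Hr. rewrite !orbit_norm_eq, (evo_id hU) by lra.
  rewrite <- (kernel_inverse_eq r s z ltac:(lra) Hz) at 1.
  rewrite <- (compl_proj_of_kernel r (U r s z)) at 1
    by (apply evo_kernel; [lra | exact Hz]).
  apply hgrow; lra.
Qed.

Lemma dichotomy_estimates (t s : R) (x : X) :
  0 <= s <= t ->
  norm (U t s (P s x)) <=
    datko_const M omega k * M * exp (- / (2 * k) * (t - s)) * norm x /\
  norm (V s t (Q t x)) <=
    datko_const M omega k * M * exp (- / (2 * k) * (t - s)) * norm x.
Proof.
intros Hst.
pose proof (datko_const_ge_1 M omega k hM homega hk).
set (c := datko_const M omega k) in *. set (e := exp _).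
assert (Hce : 0 <= c * e).
{ apply Rmult_le_pos; [lra | apply Rlt_le, exp_pos]. }
replace (c * M * e * norm x) with (c * e * (M * norm x)) by ring.
split; (eapply Rle_trans; [now apply stable_decay || now apply unstable_decay |];
  apply Rmult_le_compat_l; [exact Hce | apply norm_proj_le; lra]).
Qed.

End DichotomyOfLyapunov.
End Evolution.

Theorem corollary3p13 (K : AbsRing) (hK : K = R_AbsRing \/ K = C_AbsRing)
    (X : CompleteNormedModule K)
    (U : R -> R -> X -> X) (hU : evolution_operator U)
    (P : R -> X -> X) (hP : projection_valued P) (hUP : compatible U P) :
  uniform_exp_dichotomy U P <->
  (uniform_exp_growth U P /\
   exists (L : R -> X -> R) (k : R), (1 <= k)%R /\
     forall (t s : R) (x : X), (0 <= s <= t)%R ->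
       (L t (U t s x) + RInt (fun tau => norm (U tau s x) ^ 2) s t <= L s x)%R /\
       (0 <= L t (P t x))%R /\
       (L t (compl_proj P t x) <= 0)%R /\
       (L t (P t x) - L t (compl_proj P t x) <= k * norm x ^ 2)%R).
Proof.
assert (Hcoef : forall a b, 1 <= a -> 0 <= a * exp b).
{ intros a b Ha. pose proof (exp_pos b). nra. }
split.
- intros [N [beta [HN [Hbeta Hdich]]]]. split.
  + exists N, 1. split; [exact HN |]. split; [lra |]. intros t s Hts.
    assert (Hle : Rbar_le (N * exp (- beta * (t - s))) (N * exp (1 * (t - s)))).
    { apply Rmult_le_compat_l; [lra |]. apply exp_monotone. nra. }
    destruct (Hdich t s Hts) as [H1 H2].
    split; (eapply Rbar_le_trans; [| exact Hle]); assumption.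
  + assert (Hpt : forall t s x, 0 <= s <= t ->
      norm (U t s (P s x)) <= N * exp (- beta * (t - s)) * norm x /\
      norm (kernel_inverse U P s t (compl_proj P t x))
        <= N * exp (- beta * (t - s)) * norm x).
    { intros t s x Hts.
      now apply (proj1 (op_norm_pair_iff hU hP hUP hK t s _ Hts
        (Hcoef _ _ HN)) (Hdich t s Hts)). }
    (* (4) holds with 2 N^2 / beta; the maximum only makes the constant at least 1. *)
    exists (lyapunov (U := U) (P := P)), (Rmax 1 (2 * N ^ 2 / beta)).
    split; [apply Rmax_l |]. intros t s x Hts.
    split; [exact (lyapunov_decrease hU hP hUP Hbeta Hpt t s x Hts) |].
    destruct (lyapunov_bounds hU hP hUP Hbeta Hpt t x ltac:(lra)) as [H1 [H2 H3]].
    split; [exact H1 |]. split; [exact H2 |].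
    eapply Rle_trans; [exact H3 |].
    apply Rmult_le_compat_r; [apply pow2_ge_0 | apply Rmax_r].
- intros [[M [omega [HM [Homega Hgrow]]]] [L [k [Hk HL]]]].
  assert (Hpt : forall t s x, 0 <= s <= t ->
    norm (U t s (P s x)) <= M * exp (omega * (t - s)) * norm x /\
    norm (kernel_inverse U P s t (compl_proj P t x))
      <= M * exp (omega * (t - s)) * norm x).
  { intros t s x Hts.
    now apply (proj1 (op_norm_pair_iff hU hP hUP hK t s _ Hts
      (Hcoef _ _ HM)) (Hgrow t s Hts)). }
  pose proof (datko_const_ge_1 M omega k HM Homega Hk) as Hc.
  assert (HN : 1 <= datko_const M omega k * M) by nra.
  exists (datko_const M omega k * M), (/ (2 * k)).
  split; [exact HN |]. split; [apply Rinv_0_lt_compat; lra |].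
  intros t s Hts.
  apply (op_norm_pair_iff hU hP hUP hK t s _ Hts (Hcoef _ _ HN)). intros x.
  exact (dichotomy_estimates hU hP hUP HM Homega Hpt Hk (fun t s x => HL t s x) t s x Hts).
Qed.
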